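(* For all integers $n,r,d\ge 1$, \[ g(n;d)=\sum_{\pi\in S_d}\operatorname{sgn}(\pi)\,\bigl|W'(d,2rn;T(\pi))\bigr| , \] where the sum runs over all permutations $\pi$ of $[d]$.
   Context: Fix integers $n,r\ge 1$ and let $m=rn$. Let $U=\{u_1,\dots,u_n\}$ and $V=\{v_1,\dots,v_n\}$ be disjoint sets, totally ordered by $u_1\prec\cdots\prec u_n$ and $v_1\prec\cdots\prec v_n$. An $r$-regular bipartite multigraph on $(U,V)$ is a multiset of edges $uv$ ($u\in U$, $v\in V$) in which every vertex has degree $r$ (equivalently, an $n\times n$ matrix of nonnegative integers, the multiplicities, with all row and column sums equal to $r$). Two edges $uv,u'v'$ are noncrossing if ($u\prec u'$ and $v\prec v'$) or ($u'\prec u$ and $v'\prec v$). A planar matching is a set of pairwise noncrossing edges; $L(G)$ is the maximum number of edges of a planar matching of $G$. $g(n;d)$ is the number of $r$-regular bipartite multigraphs $G$ on $(U,V)$ with $L(G)\le d$. Walks: a walk of length $2m$ in $\mathbb Z^d$ starting at the origin whose first $m$ steps are positive unit steps and last $m$ steps are negative unit steps is written $a_1\cdots a_m\,|\,b_1\cdots b_m$ with $a_i,b_i\in[d]$, meaning the steps are $e_{a_1},\dots,e_{a_m},-e_{b_1},\dots,-e_{b_m}$ ($e_j$ the standard basis vectors). For $P\subseteq\mathbb Z^d$ (or a point), $W^*(d,2m;P)$ is the set of such walks ending in $P$. Positive steps are indexed by $U\times[r]$ and negative steps by $V\times[r]$ via $a_{u_i^s}=a_{r(i-1)+s}$, $b_{v_i^s}=b_{r(i-1)+s}$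 ($i\in[n]$, $s\in[r]$). For a permutation $\pi$ of $[d]$, the Toeplitz point is $T(\pi)=(1-\pi(1),2-\pi(2),\dots,d-\pi(d))$. $W'(d,2m;P)$ is the set of walks in $W^*(d,2m;P)$ with $a_{u^s}\ge a_{u^{s+1}}$ and $b_{v^s}\ge b_{v^{s+1}}$ for all $u\in U$, $v\in V$, $1\le s<r$. *)

(* Defs.v *)
From mathcomp Require Import all_boot all_order all_algebra all_fingroup.
Set Implicit Arguments. Unset Strict Implicit. Unset Printing Implicit Defensive.
Import GRing.Theory Num.Theory.

(* Vertices u_1..u_n and v_1..v_n are represented by 'I_n (0-based), ordered
   by the natural order.  An r-regular bipartite multigraph is given by its
   multiplicity matrix M : 'I_n * 'I_n -> nat; since every vertex has degree r,
   every multiplicity is at most r, so we take values in 'I_r.+1 (this is a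
   bijection with the nonnegative integer matrices with all line sums r). *)
Definition mgraph (n r : nat) := {ffun 'I_n * 'I_n -> 'I_r.+1}.

Definition regular (n r : nat) (M : mgraph n r) : bool :=
  [forall i : 'I_n, (\sum_(j < n) (M (i, j) : nat)) == r] &&
  [forall j : 'I_n, (\sum_(i < n) (M (i, j) : nat)) == r].

Definition noncrossing (n : nat) (e f : 'I_n * 'I_n) : bool :=
  ((e.1 < f.1) && (e.2 < f.2)) || ((f.1 < e.1) && (f.2 < e.2)).

Definition planar_matching (n r : nat) (M : mgraph n r) (S : {set 'I_n * 'I_n}) : bool :=
  [forall e in S, 0 < (M e : nat)] &&
  [forall e in S, forall f in S, (e != f) ==> noncrossing e f].

Definition Lmax (n r : nat) (M : mgraph n r) : nat :=
  \max_(S : {set 'I_n * 'I_n} | planar_matching M S) #|S|.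

Definition g (r n d : nat) : nat :=
  #|[set M : mgraph n r | regular M && (Lmax M <= d)]|.

(* Walks a_1..a_m | b_1..b_m with steps in [d] (0-based: 'I_d); position k
   (0-based) of 'I_(r*n) corresponds to u_i^s with k = r(i-1) + (s-1). *)
Definition walk_end (m d : nat) (a b : {ffun 'I_m -> 'I_d}) (j : 'I_d) : int :=
  (\sum_(k < m) ((a k == j) : nat)%:Z) - (\sum_(k < m) ((b k == j) : nat)%:Z).

(* Toeplitz point T(pi), 0-based: coordinate j is (j+1) - (pi(j)+1). *)
Definition toeplitz (d : nat) (p : 'S_d) (j : 'I_d) : int :=
  (j : nat)%:Z - (p j : nat)%:Z.

Definition block_decr (r n d : nat) (a : {ffun 'I_(r * n) -> 'I_d}) : bool :=
  [forall k : 'I_(r * n), forall k' : 'I_(r * n),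
     ((k' : nat) == k.+1) && ((k %% r).+1 < r) ==> (a k' <= a k)].

Definition Wprime (r n d : nat) (pt : 'I_d -> int) :
    {set {ffun 'I_(r * n) -> 'I_d} * {ffun 'I_(r * n) -> 'I_d}} :=
  [set w | [forall j, walk_end w.1 w.2 j == pt j] &&
           block_decr w.1 && block_decr w.2].

(* Main.v *)
Require Import Defs.
From mathcomp Require Import all_boot all_order all_algebra all_fingroup zify.
Set Implicit Arguments. Unset Strict Implicit. Unset Printing Implicit Defensive.
Import GRing.Theory Num.Theory Order.TTheory.

(** Burge's variant of the RSK correspondence sends a multigraph [M] to a pair
    of semistandard tableaux of the same shape, each containing every letter [r]
    times; the number of rows of the shape is the length of the longest strictly
    increasing chain in the support of [M], that is [Lmax M].  Hence [g r n d] is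
    the sum of the squared Kostka numbers of the shapes with at most [d] rows.
    By the Jacobi-Trudi formula, proved here by exchanging two adjacent
    coordinates at the first place where a chain of shapes violates the
    tableau condition, such a Kostka number is the alternating sum [F x] over
    permutations of the numbers of words with prescribed contents.  The
    alternating sum of the theorem is the sum of [F (content E + delta)] over
    all words [E]; as [F] is antisymmetric, sorting the argument turns it into
    the sum of [F x ^ 2] over strictly decreasing [x]. *)

(** * Local rule of the growth diagram *)

(** The skew shape [l / a] is a horizontal strip. A shape is the function giving its row lengths,
    with rows counted from 0. *)
Definition strip (a l : nat -> nat) := forall k, a k <= l k /\ l k.+1 <= a k.

Definition vanish d (a : nat -> nat) := forall k, d <= k -> a k = 0.

Section LocalRule.
Variable d : nat.

Section Carry.
Variables l u : nat -> nat.
Let mx k := maxn (l k) (u k).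
Let mn k := minn (l k) (u k).

(* [fcarry a m j] is the carry entering row [d - j]. *)
Fixpoint fcarry (a : nat -> nat) (m j : nat) : nat :=
  if j is j'.+1 then
    (fcarry a m j' - (a (d - j) - mx (d - j).+1)) + (mn (d - j) - a (d - j))
  else m.

Definition fw (a : nat -> nat) m k : nat :=
  if k is k'.+1 then mx k + minn (fcarry a m (d - k)) (a k' - mx k)
  else mx 0 + fcarry a m d.

(** Together with [bw], the inverse of the forward rule, run from row 0 down: the two equations of
    [rule] are solved for [(c k.+1, a k)] in terms of [(c k, nu k.+1)]. *)
Fixpoint bcarry (nu : nat -> nat) k : nat :=
  if k is k'.+1 then
    (bcarry nu k' - (mn k' - nu k)) + (nu k - mx k)
  else nu 0 - mx 0.

Definition bw (nu : nat -> nat) k := mn k - minn (bcarry nu k) (mn k - nu k.+1).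

(* The carry [c] runs from row [d], where it is the matrix entry [m], up to row
   [0]; at each row the pair [(c k.+1, a k)] is exchanged for [(c k, nu k.+1)]. *)
Definition rule a m nu := exists c : nat -> nat,
  [/\ c d = m, nu 0 = mx 0 + c 0,
      forall k, k < d -> c k = (c k.+1 - (a k - mx k.+1)) + (mn k - a k)
    & forall k, k < d -> nu k.+1 = mx k.+1 + minn (c k.+1) (a k - mx k.+1)].

(* Shapes at the corners of a unit square with entry [m]: [a] and [nu] are
   opposite, [l] and [u] are the other two. *)
Definition cell a m nu :=
  [/\ strip a l, strip a u, vanish d l, vanish d u & vanish d nu /\ rule a m nu].

Lemma rule_fw a m : rule a m (fw a m).
Proof.
exists (fun k => fcarry a m (d - k)); split => //=; rewrite ?subnn ?subn0 //.
move=> k kd; have -> : d - k = (d - k.+1).+1 by lia.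
by rewrite /=; have -> : d - (d - k.+1).+1 = k by lia.
Qed.

(** Row [d] of the new shape would have length [minn m (a d.-1)]; the last hypothesis makes this
    zero, so the shape stays within [d] rows. *)
Lemma cell_fw a m : 0 < d -> strip a l -> strip a u -> vanish d l -> vanish d u ->
  (0 < m -> a d.-1 = 0) -> cell a m (fw a m).
Proof.
move=> d_gt0 al au vl vu ok; split=> //; split; last exact: rule_fw.
case=> [|k] dk; first lia.
rewrite /= /mx vl // vu // max0n add0n subn0.
have [kd|kd] : k.+1 = d \/ d <= k by lia.
  rewrite -kd subnn /=; case: m ok => [|m] ok; first by rewrite min0n.
  by have := ok isT; rewrite -kd /= => ->; rewrite minn0.
by have [] := al k; rewrite (vl k) //; lia.
Qed.

Lemma cell_bw nu : strip l nu -> strip u nu -> vanish d nu ->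
  cell (bw nu) (bcarry nu d) nu.
Proof.
move=> lnu unu vnu.
have vl : vanish d l by move=> k dk; have [] := lnu k; rewrite vnu //; lia.
have vu : vanish d u by move=> k dk; have [] := unu k; rewrite vnu //; lia.
have mxle k : mx k <= nu k /\ nu k.+1 <= mn k.
  by have [? ?] := lnu k; have [? ?] := unu k; rewrite /mx /mn; lia.
split=> //.
- move=> k; have := mxle k; have := mxle k.+1; rewrite /bw /mx /mn; lia.
- move=> k; have := mxle k; have := mxle k.+1; rewrite /bw /mx /mn; lia.
split=> //; exists (bcarry nu); split=> //.
- by have := mxle 0; rewrite /= ; lia.
- by move=> k _; have := mxle k; have := mxle k.+1; rewrite /= /bw; lia.
- by move=> k _; have := mxle k; have := mxle k.+1; rewrite /= /bw; lia.
Qed.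

Lemma cell_strip a m nu : cell a m nu -> strip l nu /\ strip u nu.
Proof.
case=> al au vl vu [vnu [c [_ c0 cS nuS]]].
have mxle k : mx k <= nu k.
  case: k => [|k]; first by rewrite c0; lia.
  have [kd|dk] := ltnP k d; first by rewrite nuS //; lia.
  by rewrite /mx vl ?vu //; lia.
have nule k : nu k.+1 <= a k.
  have [kd|dk] := ltnP k d; last by rewrite vnu //; lia.
  by rewrite nuS //; have := al k; have := au k; rewrite /mx; lia.
by split=> k; have := mxle k; have := nule k; have := al k; have := au k;
  rewrite /mx; lia.
Qed.

End Carry.
(** The carries agree from row [d] upwards. Shapes are compared pointwise because they are
    functions. *)
Lemma cell_det_fw l u a m nu l' u' a' m' nu' :
  cell l u a m nu -> cell l' u' a' m' nu' ->
  l =1 l' -> u =1 u' -> a =1 a' -> m = m' -> nu =1 nu'.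
Proof.
move=> [_ _ _ _ [vnu [c [cd c0 cS nuS]]]] [_ _ _ _ [vnu' [c' [cd' c0' cS' nuS']]]].
move=> ll uu aa mm.
have cc j : j <= d -> c (d - j) = c' (d - j).
  elim: j => [|j IH] jd; first by rewrite subn0 cd cd'.
  have kd : d - j.+1 < d by lia.
  rewrite (cS _ kd) (cS' _ kd) !ll !uu !aa.
  have -> : (d - j.+1).+1 = d - j by lia.
  by rewrite IH; [|lia].
have {}cc k : k <= d -> c k = c' k.
  by move=> kd; have := cc (d - k); rewrite subKn //; apply; lia.
case=> [|k]; first by rewrite c0 c0' cc // ll uu.
have [kd|dk] := ltnP k d; last by rewrite vnu ?vnu' //; lia.
by rewrite (nuS _ kd) (nuS' _ kd) cc // !ll !uu aa.
Qed.

(** The carries agree from row 0 downwards. Comparing [c k] with [minn (l k) (u k) - nu k.+1] tells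
    which argument attains the minimum in [nu k.+1]; the other one then follows from [c k]. *)
Lemma cell_det_bw l u a m nu l' u' a' m' nu' :
  cell l u a m nu -> cell l' u' a' m' nu' ->
  l =1 l' -> u =1 u' -> nu =1 nu' -> a =1 a' /\ m = m'.
Proof.
move=> C C' ll uu nn.
case: (C) => al au vl vu [vnu [c [cd c0 cS nuS]]].
case: (C') => al' au' vl' vu' [vnu' [c' [cd' c0' cS' nuS']]].
have step k : k < d -> c k = c' k -> a k = a' k /\ c k.+1 = c' k.+1.
  move=> kd; rewrite (cS _ kd) (cS' _ kd).
  have := nuS k kd; have := nuS' k kd; rewrite -!ll -!uu -!nn.
  by have := al k; have := au k; have := al' k; have := au' k;
    rewrite -!ll -!uu; lia.
have cc k : k <= d -> c k = c' k.
  elim: k => [|k IH] kd; last by case: (step k kd (IH (ltnW kd))).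
  by have := c0; have := c0'; rewrite -!ll -!uu -!nn; lia.
split=> [k|]; last by rewrite -cd -cd' cc.
have [kd|dk] := ltnP k d; first by case: (step k kd (cc k (ltnW kd))).
by have := al k; have := al' k; rewrite vl ?vl' //; lia.
Qed.

Definition weight (a : nat -> nat) := \sum_(k < d) a k.

(** Each exchange at a row preserves the total of the numbers involved, so the sum over the rows
    telescopes and leaves the carry [m] that enters at row [d]. *)
Lemma cell_weight l u a m nu : cell l u a m nu ->
  weight a + weight nu = weight l + weight u + m.
Proof.
case=> al au vl vu [vnu [c [cd c0 cS nuS]]].
have [mx mxE] : {mx | mx = fun k => maxn (l k) (u k)} by eexists.
have [mn mnE] : {mn | mn = fun k => minn (l k) (u k)} by eexists.
have lu : weight l + weight u = weight mx + weight mn.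
  rewrite /weight -!big_split; apply: eq_bigr => k _; rewrite mxE mnE /=; lia.
have step k : k < d -> c k + nu k.+1 + a k = c k.+1 + mx k.+1 + mn k.
  move=> kd; rewrite cS // nuS // mxE mnE.
  by have := al k; have := au k; lia.
have mx0 : nu 0 = mx 0 + c 0 by rewrite mxE.
have mxd : mx d = 0 by rewrite mxE vl // vu.
have part k : k <= d -> \sum_(i < k) a i + \sum_(i < k) nu i + nu k
   = \sum_(i < k) mx i + \sum_(i < k) mn i + mx k + c k.
  elim: k => [|k IH] kd; first by rewrite !big_ord0 mx0.
  rewrite !big_ord_recr /=; move: (IH (ltnW kd)) (step k kd).
  move: (\sum_(i < k) a i) (\sum_(i < k) nu i) (\sum_(i < k) mx i) (\sum_(i < k) mn i).
  by clear; lia.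
have := part d (leqnn d); rewrite lu /weight cd mxd vnu //; lia.
Qed.

Definition rows (a : nat -> nat) L := forall k, (0 < a k) = (k < L).

(** This is the recursion for longest chains. Strips force [y] and [z] into [{x, x+1}], and [nu] has
    at most [x+1] rows. If [y = z = x], the carry [m] passes unchanged through the empty rows and
    reaches row [x], which becomes nonempty exactly when [m > 0]. *)
Lemma cell_rows l u a m nu x y z : cell l u a m nu ->
  rows a x -> rows l y -> rows u z -> rows nu (maxn (maxn y z) (x + (0 < m))).
Proof.
move=> C ra rl ru k.
have [lnu unu] := cell_strip C.
case: C => al au vl vu [vnu [c [cd c0 cS nuS]]].
have yx : x <= y /\ x <= z.
  split; rewrite leqNgt; apply/negP => h.
    by have := ra y; have := rl y; have := al y; rewrite h ltnn; lia.
  by have := ra z; have := ru z; have := au z; rewrite h ltnn; lia.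
have zx : y <= x.+1 /\ z <= x.+1.
  split; rewrite leqNgt; apply/negP => h.
    by have := ra x; have := rl x.+1; have := al x; rewrite h ltnn; lia.
  by have := ra x; have := ru x.+1; have := au x; rewrite h ltnn; lia.
have xd : x <= d.
  rewrite leqNgt; apply/negP => h.
  by have := ra d; have := al d; rewrite vl // h; lia.
have cm : y = x -> z = x -> c x = m.
  move=> yE zE; rewrite -cd.
  suff cj j : j <= d - x -> c (d - j) = c d.
    by have := cj (d - x) (leqnn _); rewrite subKn.
  elim: j => [|j IH] jd; first by rewrite subn0.
  have kd : d - j.+1 < d by lia.
  rewrite cS //; have -> : (d - j.+1).+1 = d - j by lia.
  rewrite IH; last lia.
  by have := ra (d - j.+1); have := rl (d - j.+1); have := ru (d - j.+1); lia.
have nule j : nu j.+1 <= a j.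
  have [jd|dj] := ltnP j d; last by rewrite vnu //; lia.
  by rewrite nuS //; have := al j; have := au j; lia.
have [kM|] := ltnP k (maxn y z).
  have -> : k < maxn (maxn y z) (x + (0 < m)) by lia.
  by have := rl k; have := ru k; have := lnu k; have := unu k; lia.
move=> kM.
have [xk|kx] := ltnP x k.
  case: k kM xk => [|k] // kM xk; have := nule k; have := ra k; lia.
have kE : k = x by lia.
have {}cm := cm _ _; subst k.
have yE : y = x by lia.
have zE : z = x by lia.
have -> : (x < maxn (maxn y z) (x + (0 < m))) = (0 < m) by lia.
rewrite -cm //; case: (x) xd rl ru ra yE zE => [|x'] xd rl ru ra yE zE.
  by rewrite c0; have := rl 0; have := ru 0; lia.
rewrite nuS //; have := rl x'.+1; have := ru x'.+1; have := ra x'; lia.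
Qed.

End LocalRule.

(** * Growth diagrams *)

(** Length of the longest strictly increasing chain in the support of the first [i] rows and [j]
    columns of [M]. *)
Fixpoint chainlen (M : nat -> nat -> nat) i : nat -> nat :=
  if i is i'.+1 then
    fix row j := if j is j'.+1 then
      maxn (maxn (chainlen M i' j) (row j')) (chainlen M i' j' + (0 < M i' j'))
    else 0
  else fun=> 0.

Lemma chainlenS M i j : chainlen M i.+1 j.+1 =
  maxn (maxn (chainlen M i j.+1) (chainlen M i.+1 j))
       (chainlen M i j + (0 < M i j)).
Proof. by []. Qed.

Lemma chainlen_mono M i j i' j' : i <= i' -> j <= j' ->
  chainlen M i j <= chainlen M i' j'.
Proof.
move=> ii jj; apply: (@leq_trans (chainlen M i' j)).
  elim: i' ii => [|i' IH]; first by rewrite leqn0 => /eqP->.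
  rewrite leq_eqVlt ltnS => /predU1P[->//|/IH le]; apply: leq_trans le _.
  by case: j {jj IH} => [|j]; [case: i' | rewrite chainlenS; lia].
elim: j' jj => [|j' IH]; first by rewrite leqn0 => /eqP->.
rewrite leq_eqVlt ltnS => /predU1P[->//|/IH le]; apply: leq_trans le _.
by case: i' {ii IH} => [|i'] //; rewrite chainlenS; lia.
Qed.

Section Grid.
Variables d n : nat.

Fixpoint fgrid (M : nat -> nat -> nat) i : nat -> nat -> nat :=
  if i is i'.+1 then
    fix row j := if j is j'.+1 then
      fw d (fgrid M i' j) (row j') (fgrid M i' j') (M i' j')
    else fun=> 0
  else fun _ _ => 0.

(** Growth diagrams as a relation, so that diagrams built forwards from the entries and backwards
    from the far sides obey the same lemmas. *)
Definition grid (M : nat -> nat -> nat) (L : nat -> nat -> nat -> nat) :=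
  [/\ forall j, j <= n -> L 0 j =1 (fun=> 0),
      forall i, i <= n -> L i 0 =1 (fun=> 0)
    & forall i j, i < n -> j < n ->
        cell d (L i j.+1) (L i.+1 j) (L i j) (M i j) (L i.+1 j.+1)].

(** By induction the shape at [(i, j)] has [chainlen M i j] rows. A nonzero entry makes the chain
    length grow across its cell, so before the cell it is below [d], as [cell_fw] requires. *)
Lemma fgrid_grid M : 0 < d -> chainlen M n n <= d -> grid M (fgrid M).
Proof.
move=> d_gt0 Md.
pose P i j := vanish d (fgrid M i j) /\ rows (fgrid M i j) (chainlen M i j).
suff main i : i <= n -> forall j, j <= n ->
   [/\ P i j, 0 < j -> strip (fgrid M i j.-1) (fgrid M i j)
     & 0 < i -> strip (fgrid M i.-1 j) (fgrid M i j) /\ (0 < j ->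
        cell d (fgrid M i.-1 j) (fgrid M i j.-1) (fgrid M i.-1 j.-1)
             (M i.-1 j.-1) (fgrid M i j))].
  split=> [j _ k //|[|i] _ k //|i j ni nj].
  by have [_ _ /(_ isT)[_ /(_ isT)]] := main i.+1 ni j.+1 nj.
elim: i => [|i IH] ni j.
  by split; [split=> k | move=> _ k | ].
elim: j => [|j IHj] nj.
  by split; [split=> k | | split=> //; case: (i)].
have [[v0 r0] _ _] := IH (ltnW ni) j (ltnW nj).
have [[v1 r1] /(_ isT) s1 _] := IH (ltnW ni) j.+1 nj.
have [[v2 r2] _ /(_ isT)[s2 _]] := IHj (ltnW nj).
have C : cell d (fgrid M i j.+1) (fgrid M i.+1 j) (fgrid M i j) (M i j)
              (fgrid M i.+1 j.+1).
  apply: cell_fw => // m0; apply/eqP; rewrite -leqn0 leqNgt r0 -leqNgt.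
  have : chainlen M i.+1 j.+1 <= d by apply: leq_trans Md; apply: chainlen_mono.
  by rewrite chainlenS m0; lia.
have [cs1 cs2] := cell_strip C.
split=> //; split; last exact: cell_rows C r0 r1 r2.
by case: (C) => _ _ _ _ [].
Qed.

Section Bgrid.
Variables P Q : nat -> nat -> nat.

(* [bgrid i j] is the shape at the vertex [(n - i, n - j)]. *)
Fixpoint bgrid i : nat -> nat -> nat :=
  if i is i'.+1 then
    fix row j := if j is j'.+1 then bw (row j') (bgrid i' j) (bgrid i' j')
    else Q (n - i)
  else fun j => P (n - j).

Hypotheses (P0 : P 0 =1 (fun=> 0)) (Q0 : Q 0 =1 (fun=> 0)).
Hypotheses (PQ : P n =1 Q n) (vP : vanish d (P n)).
Hypothesis sP : forall j, j < n -> strip (P j) (P j.+1).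
Hypothesis sQ : forall i, i < n -> strip (Q i) (Q i.+1).

(** Backward growth: two chains of horizontal strips from the empty shape to a common shape are the
    far sides of a growth diagram. *)
Lemma bgrid_grid : exists M L, [/\ grid M L,
  forall j, j <= n -> L n j =1 P j & forall i, i <= n -> L i n =1 Q i].
Proof.
have svan a b : strip a b -> vanish d b -> vanish d a.
  by move=> ab vb k dk; have := ab k; rewrite vb //; lia.
have main i : i <= n -> forall j, j <= n ->
   [/\ vanish d (bgrid i j), 0 < j -> strip (bgrid i j) (bgrid i j.-1)
     & 0 < i -> strip (bgrid i j) (bgrid i.-1 j) /\ (0 < j ->
        cell d (bgrid i j.-1) (bgrid i.-1 j) (bgrid i j)
           (bcarry (bgrid i j.-1) (bgrid i.-1 j) (bgrid i.-1 j.-1) d)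
           (bgrid i.-1 j.-1))].
  elim: i => [|i IH] ni j.
    elim: j => [|j IHj] nj; first by split=> //; rewrite /= subn0.
    have st : strip (bgrid 0 j.+1) (bgrid 0 j).
      rewrite /=; have -> : n - j = (n - j.+1).+1 by lia.
      by apply: sP; lia.
    by split=> //; apply: svan st _; case: IHj => //; lia.
  elim: j => [|j IHj] nj.
    have st : strip (bgrid i.+1 0) (bgrid i 0).
      have h : strip (Q (n - i.+1)) (Q (n - i.+1).+1) by apply: sQ; lia.
      have E : (n - i.+1).+1 = n - i by lia.
      case: i E ni h {IH} => [|i] E ni h /=; last by rewrite -E.
      (* The corner [bgrid 0 0] is [P n] by definition, hence the use of [PQ] when [i = 0]. *)
      by move=> k; have := h k; rewrite E subn0 -!PQ.
    split=> //; apply: svan st _.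
    by case: (IH (ltnW ni) 0 (leq0n _)).
  have [v0 _ _] := IH (ltnW ni) j (ltnW nj).
  have [_ /(_ isT) s1 _] := IH (ltnW ni) j.+1 nj.
  have [_ _ /(_ isT)[s2 _]] := IHj (ltnW nj).
  have C := cell_bw s2 s1 v0.
  case: (C) => cs1 cs2 v1 v2 _.
  by split=> //; apply: svan cs1 _.
pose L i j := bgrid (n - i) (n - j).
have LQ i : i <= n -> L i n =1 Q i.
  move=> ni k; rewrite /L subnn; case E: (n - i) => [|i'] /=.
    by rewrite subn0 PQ; congr (Q _ _); lia.
  by congr (Q _ _); lia.
have LP j : j <= n -> L n j =1 P j.
  by move=> nj k; rewrite /L subnn /=; congr (P _ _); lia.
pose M i j := bcarry (L i j.+1) (L i.+1 j) (L i.+1 j.+1) d.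
exists M, L; split=> //.
have cellL i j : i < n -> j < n ->
    cell d (L i j.+1) (L i.+1 j) (L i j) (M i j) (L i.+1 j.+1).
  move=> ni nj; have [_ _ h] := main (n - i) (leq_subr _ _) (n - j) (leq_subr _ _).
  have [_ /(_ _)] := h ltac:(lia); rewrite -!subnS; apply; lia.
(* Shapes grow along rows and columns of the diagram. Row 0 ends in [Q 0] and column 0 ends in
   [P 0], both empty, so all their shapes are empty. *)
have decr a b : strip a b -> b =1 (fun=> 0) -> a =1 (fun=> 0).
  by move=> ab b0 k; have := ab k; rewrite b0; lia.
split=> //.
  move=> j nj; rewrite -(subKn nj); elim: (n - j) (leq_subr j n) => [|j' IH] jn.
    by rewrite subn0 => k; rewrite LQ.
  apply: decr (IH (ltnW jn)).
  have [_ h _] := main n (leqnn _) j'.+1 jn.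
  by rewrite /L subn0 !subKn ?(ltnW jn) //; apply: h.
move=> i ni; rewrite -(subKn ni); elim: (n - i) (leq_subr i n) => [|i' IH] jn.
  by rewrite subn0 => k; rewrite LP.
apply: decr (IH (ltnW jn)).
have [_ _ h] := main i'.+1 jn n (leqnn _).
by rewrite /L subn0 !subKn ?(ltnW jn) //; have [] := h isT.
Qed.

End Bgrid.

(** * Numbers of rows and sizes of the shapes in a growth diagram *)

Section Facts.
Variables (M : nat -> nat -> nat) (L : nat -> nat -> nat -> nat).
Hypothesis G : grid M L.

Lemma grid_rows i j : i <= n -> j <= n -> rows (L i j) (chainlen M i j).
Proof.
case: G => G0 G1 GC.
elim: i j => [|i IH] j ni; first by move=> nj k; rewrite G0.
elim: j => [|j IHj] nj; first by move=> k; rewrite G1.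
rewrite chainlenS; apply: cell_rows (GC i j ni nj) _ _ _; [apply: IH|apply: IH|apply: IHj]; lia.
Qed.

Lemma grid_chainlen : chainlen M n n <= d.
Proof.
have := grid_rows (leqnn n) (leqnn n) d; case: G => _ _.
case: (n) => [|n'] // GC; have [_ _ _ _ [v _]] := GC n' n' (leqnn _) (leqnn _).
by rewrite v // => /esym; rewrite ltnNge => /negbFE.
Qed.

Lemma grid_stripr i j : i <= n -> j < n -> strip (L i j) (L i j.+1).
Proof.
case: G => G0 G1 GC.
case: i => [|i] ni nj; first by move=> k; rewrite !G0 //; lia.
by have [_] := cell_strip (GC i j ni nj).
Qed.

Lemma grid_stripd i j : i < n -> j <= n -> strip (L i j) (L i.+1 j).
Proof.
case: G => G0 G1 GC.
case: j => [|j] ni nj; first by move=> k; rewrite !G1 //; lia.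
by have [] := cell_strip (GC i j ni nj).
Qed.

Lemma grid_vanish i j : i <= n -> j <= n -> vanish d (L i j).
Proof.
case: G => G0 G1 GC.
case: i => [|i] ni nj; first by move=> k; rewrite !G0 //; lia.
case: j nj => [|j] nj; first by move=> k; rewrite !G1 //; lia.
by have [_ _ _ _ []] := GC i j ni nj.
Qed.

Lemma weight0 a : a =1 (fun=> 0) -> weight d a = 0.
Proof. by move=> a0; rewrite /weight big1. Qed.

(** [cell_weight] telescopes down a column. For [i = n], a column sum of [M] is the size of a strip
    on the last row of shapes, so regularity means that every letter occurs [r] times. *)
Lemma grid_col i j : i <= n -> j < n ->
  weight d (L i j.+1) = weight d (L i j) + \sum_(k < i) M k j.
Proof.
case: G => G0 G1 GC; elim: i => [|i IH] ni nj.
  by rewrite big_ord0 !weight0 //; apply: G0; lia.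
rewrite big_ord_recr /=; move: (cell_weight (GC i j ni nj)) (IH (ltnW ni) nj).
by move: (\sum_(k < i) M k j); clear; lia.
Qed.

Lemma grid_row i j : i < n -> j <= n ->
  weight d (L i.+1 j) = weight d (L i j) + \sum_(k < j) M i k.
Proof.
case: G => G0 G1 GC; elim: j => [|j IH] ni nj.
  by rewrite big_ord0 !weight0 //; apply: G1; lia.
rewrite big_ord_recr /=; move: (cell_weight (GC i j ni nj)) (IH ni (ltnW nj)).
by move: (\sum_(k < j) M i k); clear; lia.
Qed.

End Facts.

Lemma grid_det_bw M L M' L' : grid M L -> grid M' L' ->
  (forall j, j <= n -> L n j =1 L' n j) -> (forall i, i <= n -> L i n =1 L' i n) ->
  forall i j, i < n -> j < n -> M i j = M' i j.
Proof.
move=> [_ _ GC] [_ _ GC'] Ln Rn.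
have main i : i <= n -> forall j, j <= n -> L (n - i) (n - j) =1 L' (n - i) (n - j).
  elim: i => [|i IH] ni j; first by rewrite subn0 => _; apply: Ln; lia.
  elim: j => [|j IHj] nj; first by rewrite subn0; apply: Rn; lia.
  have ci : n - i.+1 < n by lia. have cj : n - j.+1 < n by lia.
  have Ei : (n - i.+1).+1 = n - i by lia. have Ej : (n - j.+1).+1 = n - j by lia.
  have C := GC _ _ ci cj. have C' := GC' _ _ ci cj; rewrite !Ei !Ej in C C'.
  by apply: (proj1 (cell_det_bw C C' _ _ _)); [apply: IHj|apply: IH|apply: IH]; lia.
move=> i j ni nj.
have eL i' j' : i' <= n -> j' <= n -> L i' j' =1 L' i' j'.
  by move=> hi hj; rewrite -(subKn hi) -(subKn hj); apply: main; lia.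
by apply: (proj2 (cell_det_bw (GC i j ni nj) (GC' i j ni nj) _ _ _)); apply: eL; lia.
Qed.

Lemma grid_det_fw M L M' L' : grid M L -> grid M' L' ->
  (forall i j, i < n -> j < n -> M i j = M' i j) ->
  forall i j, i <= n -> j <= n -> L i j =1 L' i j.
Proof.
move=> [G0 G1 GC] [G0' G1' GC'] MM; elim=> [|i IH] j ni.
  by move=> nj k; rewrite G0 ?G0'.
elim: j => [|j IHj] nj; first by move=> k; rewrite G1 ?G1'.
apply: cell_det_fw (GC i j ni nj) (GC' i j ni nj) _ _ _ (MM i j ni nj);
  [apply: IH|apply: IHj|apply: IH]; lia.
Qed.

End Grid.

(** * Planar matchings as increasing chains *)

Section PlanarMatchings.
Variables n r : nat.
Implicit Types (M : mgraph n r) (S : {set 'I_n * 'I_n}) (e f : 'I_n * 'I_n).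

Definition entry M (i j : nat) : nat :=
  if insub i is Some i' then if insub j is Some j' then M (i', j') else 0 else 0.

Lemma entryE M (i j : 'I_n) : entry M i j = M (i, j).
Proof. by rewrite /entry !valK. Qed.

Lemma planar_matchingP M S :
  reflect ({in S, forall e, 0 < M e} /\
           {in S &, forall e f, e != f -> noncrossing e f})
          (planar_matching M S).
Proof.
apply: (iffP andP) => [[/forall_inP h1 /forall_inP h2]|[h1 h2]]; split=> //.
- by move=> e f eS fS; move/forall_inP: (h2 e eS) => /(_ f fS)/implyP.
- exact/forall_inP.
- by apply/forall_inP=> e eS; apply/forall_inP => f fS; apply/implyP/h2.
Qed.

(** Three cases match the three terms of the maximum. If the corner edge is in [S], all other edges
    lie strictly before it in both coordinates. Otherwise an edge of [S] in the last row excludes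
    edges in the last column, or else the last row is empty. *)
Lemma card_planar_le M S i j : planar_matching M S -> i <= n -> j <= n ->
  #|[set e in S | (e.1 < i) && (e.2 < j)]| <= chainlen (entry M) i j.
Proof.
move=> /planar_matchingP[Spos Snc].
elim: i j => [|i IH] j ni.
  by rewrite (_ : [set _ in _ | _] = set0) ?cards0 //; apply/setP=> e; rewrite !inE andbF.
elim: j => [|j IHj] nj.
  by rewrite (_ : [set _ in _ | _] = set0) ?cards0 //; apply/setP=> e; rewrite !inE !andbF.
rewrite chainlenS; have [e eE] : {e | e = (Ordinal ni, Ordinal nj)} by eexists.
have [eS|eS] := boolP (e \in S).
  have M0 : 0 < entry M i j by have := Spos e eS; rewrite eE -entryE.
  apply: (@leq_trans #|e |: [set e in S | (e.1 < i) && (e.2 < j)]|).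
    apply/subset_leq_card/subsetP=> f; rewrite !inE => /andP[fS lt].
    case: (eqVneq f e) => //= ne; rewrite fS /=.
    move: (Snc e f eS fS) lt; rewrite eq_sym ne /noncrossing eE /= => /(_ isT); clear; lia.
  apply: leq_trans (leq_card_setU _ _) _; rewrite cards1 M0.
  by apply: leq_trans (leq_add (leqnn 1) (IH j (ltnW ni) (ltnW nj))) _; clear; lia.
have [/existsP[[fa fb] /and3P[fS /eqP f1 f2]]|] :=
  boolP [exists f : 'I_n * 'I_n, [&& f \in S, f.1 == i :> nat & f.2 <= j]].
  apply: (@leq_trans #|[set e in S | (e.1 < i.+1) && (e.2 < j)]|); last first.
    by move: (IHj (ltnW nj)); clear; lia.
  apply/subset_leq_card/subsetP=> -[ha hb]; rewrite !inE /= in f1 f2 *.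
  move=> /and3P[hS h1 h2]; rewrite hS h1 /= ltnNge; apply/negP => jh.
  have nefS a b : (a, b) \in S -> ~ (a = i :> nat /\ b = j :> nat).
    move=> abS [ai bj]; case/negP: eS; rewrite eE.
    by rewrite (_ : (_, _) = (a, b)) //; congr pair; apply: val_inj.
  move: (nefS _ _ hS) (nefS _ _ fS) (Snc _ _ fS hS).
  case: eqP => [[fha fhb]|_ _ nf /(_ isT)]; first by subst ha hb; lia.
  have hfb : (hb : nat) = j by apply/eqP; rewrite eqn_leq -ltnS h2.
  by rewrite /noncrossing /=; lia.
rewrite negb_exists => /forallP no.
apply: (@leq_trans #|[set e in S | (e.1 < i) && (e.2 < j.+1)]|); last first.
  by move: (IH j.+1 (ltnW ni) nj); clear; lia.
apply/subset_leq_card/subsetP=> -[ha hb]; rewrite !inE /= => /and3P[hS h1 h2].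
by move: (no (ha, hb)); rewrite hS /=; lia.
Qed.

(** The matching follows the term attaining the maximum. If only the third term does, the corner
    entry is nonzero and its edge is added. *)
Lemma exists_planar M i j : i <= n -> j <= n -> exists S, [/\ planar_matching M S,
  {in S, forall e, (e.1 < i) && (e.2 < j)} & #|S| = chainlen (entry M) i j].
Proof.
have P0 : planar_matching M set0.
  by apply/planar_matchingP; split=> [e|e f]; rewrite inE.
elim: i j => [|i IH] j ni.
  by exists set0; split; rewrite ?cards0 // => e; rewrite inE.
elim: j => [|j IHj] nj.
  by exists set0; split; rewrite ?cards0 // => e; rewrite inE.
rewrite chainlenS; set a := chainlen _ i j.+1; set b := chainlen _ i.+1 j.
have [S1 [P1 D1 C1]] := IH j.+1 (ltnW ni) nj.
have [S2 [P2 D2 C2]] := IHj (ltnW nj).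
have [S3 [/planar_matchingP[pos nc] D3 C3]] := IH j (ltnW ni) (ltnW nj).
have [le1|lt1] := leqP (maxn b (chainlen (entry M) i j + (0 < entry M i j))) a.
  by exists S1; split=> // [e /D1|]; [lia|rewrite C1 -/a; lia].
have [le2|lt2] := leqP (chainlen (entry M) i j + (0 < entry M i j)) b.
  by exists S2; split=> // [e /D2|]; [lia|rewrite C2 -/b; lia].
have M0 : 0 < entry M i j.
  have : chainlen (entry M) i j <= a by apply: chainlen_mono.
  by case: (0 < entry M i j) lt1 lt2 => //; lia.
have [e eE] : {e | e = (Ordinal ni, Ordinal nj)} by eexists.
exists (e |: S3); split.
- apply/planar_matchingP; split.
    by move=> f /setU1P[->|/pos //]; rewrite eE -entryE.
  move=> f h /setU1P[->|fS] /setU1P[->|hS]; rewrite ?eqxx //; last exact: nc.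
    by move=> _; have := D3 h hS; rewrite /noncrossing eE /=; lia.
  by move=> _; have := D3 f fS; rewrite /noncrossing eE /=; lia.
- by move=> f /setU1P[->|/D3]; rewrite ?eE /=; lia.
rewrite cardsU1 C3 M0; case: (boolP (e \in S3)) => [/D3|_]; rewrite ?eE /=; lia.
Qed.

Lemma Lmax_chainlen M : Lmax M = chainlen (entry M) n n.
Proof.
apply/eqP; rewrite eqn_leq; apply/andP; split.
  apply/bigmax_leqP => S PS; apply: leq_trans (card_planar_le PS (leqnn n) (leqnn n)).
  by apply/subset_leq_card/subsetP=> e eS; rewrite inE eS !ltn_ord.
have [S [PS _ <-]] := exists_planar M (leqnn n) (leqnn n).
exact: leq_bigmax_cond.
Qed.

End PlanarMatchings.

(** * The Burge correspondence *)

Section Tableaux.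
Variables n r d : nat.
Local Notation filling := {ffun 'I_n -> {ffun 'I_d -> 'I_r.+1}}.
Implicit Types E : filling.

Definition height (e : {ffun 'I_d -> 'I_r.+1}) (k : nat) : nat :=
  if insub k is Some k' then e k' else 0.

Lemma heightE e (k : 'I_d) : height e k = e k.
Proof. by rewrite /height valK. Qed.

Lemma height_ge e k : d <= k -> height e k = 0.
Proof. by move=> dk; rewrite /height insubN // -leqNgt. Qed.

(* Row [k] of the shape of the first [i] letters of the tableau [E], where
   [E i k] is the number of letters [i] in row [k]. *)
Definition part E (i k : nat) : nat := \sum_(i' < n | i' < i) height (E i') k.

Definition row_sums E := [forall i, \sum_(k < d) (E i k : nat) == r].

(** Semistandardness, stated as: the boxes of each letter form a horizontal strip. *)
Definition tableau E := row_sums E &&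
  [forall i : 'I_n, forall k : 'I_d, part E i.+1 k.+1 <= part E i k].

Lemma part0 E : part E 0 =1 (fun=> 0).
Proof. by move=> k; rewrite /part big_pred0. Qed.

Lemma partS E (i : 'I_n) k : part E i.+1 k = part E i k + height (E i) k.
Proof.
rewrite /part (bigD1 i) //= addnC; congr addn; apply: eq_bigl => j.
by rewrite -(inj_eq val_inj) /=; lia.
Qed.

Lemma vanish_part E i : vanish d (part E i).
Proof. by move=> k dk; rewrite /part big1 // => j _; apply: height_ge. Qed.

Lemma weight_partS E (i : 'I_n) :
  weight d (part E i.+1) = weight d (part E i) + \sum_(k < d) E i k.
Proof.
rewrite /weight -big_split; apply: eq_bigr => k _.
by rewrite partS heightE.
Qed.

Lemma tableau_strip E : tableau E ->
  forall i, i < n -> strip (part E i) (part E i.+1).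
Proof.
move=> /andP[_ /forallP st] i ni k; split.
  by rewrite (partS E (Ordinal ni)) leq_addr.
have [kd|dk] := ltnP k d; last by rewrite vanish_part //; lia.
exact: (forallP (st (Ordinal ni)) (Ordinal kd)).
Qed.

Definition increments (P : nat -> nat -> nat) : filling :=
  [ffun i : 'I_n => [ffun k : 'I_d => inord (P i.+1 k - P i k)]].

Section Increments.
Variable P : nat -> nat -> nat.
Hypothesis P0 : P 0 =1 (fun=> 0).
Hypothesis vP : forall i, i <= n -> vanish d (P i).
Hypothesis sP : forall i, i < n -> strip (P i) (P i.+1).
Hypothesis wP : forall i, i < n -> weight d (P i.+1) = weight d (P i) + r.

(** A strip of size [r] has at most [r] boxes in a row, so [inord] does not truncate. *)
Lemma incrementsE (i : 'I_n) (k : 'I_d) : increments P i k = P i.+1 k - P i k :> nat.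
Proof.
rewrite !ffunE inordK // ltnS.
have : \sum_(k < d) (P i.+1 k - P i k) = r.
  apply: (@addnI (weight d (P i))); rewrite -wP // -big_split.
  apply: eq_bigr => k' _ /=; have [le _] := sP (ltn_ord i) k'.
  by rewrite subnKC.
by move=> <-; rewrite (bigD1 k) //= leq_addr.
Qed.

Lemma part_increments i : i <= n -> part (increments P) i =1 P i.
Proof.
elim: i => [|i IH] ni k; first by rewrite part0 P0.
rewrite (partS _ (Ordinal ni)) IH ?(ltnW ni) //.
have [kd|dk] := ltnP k d; last by rewrite height_ge // !vP // ltnW.
rewrite (heightE _ (Ordinal kd)) incrementsE /=.
by have [le _] := sP ni k; rewrite subnKC.
Qed.

Lemma tableau_increments : tableau (increments P).
Proof.
apply/andP; split; apply/forallP => i.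
  apply/eqP; apply/(@addnI (weight d (part (increments P) i))).
  rewrite -weight_partS /weight.
  under eq_bigr do rewrite part_increments //.
  under [in RHS]eq_bigr do rewrite part_increments ?(ltnW (ltn_ord i)) //.
  exact: wP.
apply/forallP => k; rewrite !part_increments ?(ltnW (ltn_ord i)) //.
by have [] := sP (ltn_ord i) k.
Qed.

End Increments.

Lemma part_inj E E' : (forall i, i <= n -> part E i =1 part E' i) -> E = E'.
Proof.
move=> h; apply/ffunP => i; apply/ffunP => k; apply: val_inj.
rewrite /= -!heightE; apply: (@addnI (part E i k)).
rewrite -partS h // h ?(ltnW (ltn_ord i)) //.
by rewrite partS.
Qed.

End Tableaux.

Section Burge.
Variables n r d : nat.
Hypothesis d_gt0 : 0 < d.
Local Notation filling := {ffun 'I_n -> {ffun 'I_d -> 'I_r.+1}}.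

Definition tableau_pairs : {set filling * filling} :=
  [set T | [&& tableau T.1, tableau T.2
             & [forall k : 'I_d, part T.1 n k == part T.2 n k]]].

Definition burge (M : mgraph n r) : filling * filling :=
  (increments n r d (fgrid d (entry M) n),
   increments n r d (fun i => fgrid d (entry M) i n)).

Let good (M : mgraph n r) := regular M && (Lmax M <= d).

Lemma regularP (M : mgraph n r) : reflect
  ((forall i, i < n -> \sum_(j < n) entry M i j = r) /\
   (forall j, j < n -> \sum_(i < n) entry M i j = r)) (regular M).
Proof.
apply: (iffP andP) => [[/forallP h1 /forallP h2]|[h1 h2]]; split.
- move=> i ni; rewrite -[RHS](eqP (h1 (Ordinal ni))); apply: eq_bigr => j _.
  by rewrite -entryE.
- move=> j nj; rewrite -[RHS](eqP (h2 (Ordinal nj))); apply: eq_bigr => i _.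
  by rewrite -entryE.
- apply/forallP => i; apply/eqP; rewrite -[RHS](h1 i) //.
  by apply: eq_bigr => j _; rewrite entryE.
- apply/forallP => j; apply/eqP; rewrite -[RHS](h2 j) //.
  by apply: eq_bigr => i _; rewrite entryE.
Qed.

Lemma good_grid M : good M -> grid d n (entry M) (fgrid d (entry M)).
Proof. by case/andP=> _; rewrite Lmax_chainlen => /fgrid_grid; apply. Qed.

Section Sides.
Variables (M : mgraph n r) (L : nat -> nat -> nat -> nat).
Hypotheses (regM : regular M) (G : grid d n (entry M) L).

Lemma side1P : [/\ L n 0 =1 (fun=> 0), forall j, j <= n -> vanish d (L n j),
  forall j, j < n -> strip (L n j) (L n j.+1) &
  forall j, j < n -> weight d (L n j.+1) = weight d (L n j) + r].
Proof.
have /regularP[_ cM] := regM; have [_ G1 _] := G.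
split=> [|j nj|j nj|j nj]; first exact: G1; first by apply: (grid_vanish G).
  exact: (grid_stripr G (leqnn n) nj).
by rewrite (grid_col G) // cM.
Qed.

Lemma side2P : [/\ L 0 n =1 (fun=> 0), forall i, i <= n -> vanish d (L i n),
  forall i, i < n -> strip (L i n) (L i.+1 n) &
  forall i, i < n -> weight d (L i.+1 n) = weight d (L i n) + r].
Proof.
have /regularP[rM _] := regM; have [G0 _ _] := G.
split=> [|j nj|j nj|j nj]; first exact: G0; first by apply: (grid_vanish G).
  exact: (grid_stripd G nj (leqnn n)).
by rewrite (grid_row G) // rM.
Qed.

End Sides.

Lemma burge_part M : good M ->
  (forall j, j <= n -> part (burge M).1 j =1 fgrid d (entry M) n j) /\
  (forall i, i <= n -> part (burge M).2 i =1 fgrid d (entry M) i n).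
Proof.
move=> gM; have G := good_grid gM; have /andP[rM _] := gM.
have [a0 av ast aw] := side1P rM G; have [b0 bv bst bw] := side2P rM G.
by split=> i ni; [apply: part_increments | apply: (@part_increments _ _ _ (fun i => fgrid d _ i n))].
Qed.

(** The two tableaux record the shapes on the far sides, and these determine the entries by
    [grid_det_bw]. *)
Lemma burge_inj : {in good &, injective burge}.
Proof.
move=> M M' gM gM' eqMM'; have [P1 P2] := burge_part gM; have [P1' P2'] := burge_part gM'.
apply/ffunP => -[i j]; apply: val_inj; rewrite /= -!entryE.
apply: (grid_det_bw (good_grid gM) (good_grid gM')) => // k nk l.
  by rewrite -P1 // -P1' // eqMM'.
by rewrite -P2 // -P2' // eqMM'.
Qed.

Lemma burge_in M : good M -> burge M \in tableau_pairs.
Proof.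
move=> gM; have G := good_grid gM; have /andP[rM _] := gM.
have [a0 av ast aw] := side1P rM G; have [b0 bv bst bw] := side2P rM G.
have [P1 P2] := burge_part gM.
rewrite inE !tableau_increments //=; apply/forallP => k.
by rewrite P1 // P2.
Qed.

(** Backward growth from the two tableaux yields entries [M0] with line sums [r], hence entries at
    most [r]. Uniqueness of forward growth identifies the diagram with [fgrid], whose far sides are
    then the given tableaux. *)
Lemma burge_onto T : T \in tableau_pairs -> exists2 M, good M & burge M = T.
Proof.
case: T => E E'; rewrite inE /= => /and3P[tE tE' /forallP eqE].
have eqn : part E n =1 part E' n.
  move=> k; have [kd|dk] := ltnP k d; last by rewrite !vanish_part.
  exact/eqP/(eqE (Ordinal kd)).
have [M0 [L [G LP LQ]]] := bgrid_grid (part0 E) (part0 E') eqn (@vanish_part _ _ _ E n)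
  (tableau_strip tE) (tableau_strip tE').
have wE (F : filling) i : tableau F -> i < n ->
    weight d (part F i.+1) = weight d (part F i) + r.
  case/andP=> /forallP h _ ni.
  by rewrite (weight_partS F (Ordinal ni)) (eqP (h (Ordinal ni))).
have weq a b : a =1 b -> weight d a = weight d b.
  by move=> ab; apply: eq_bigr.
have rM0 i : i < n -> \sum_(j < n) M0 i j = r.
  move=> ni; apply: (@addnI (weight d (L i n))).
  by rewrite -(grid_row G) // (weq _ _ (LQ _ ni)) (weq _ _ (LQ _ (ltnW ni))) wE.
have cM0 j : j < n -> \sum_(i < n) M0 i j = r.
  move=> nj; apply: (@addnI (weight d (L n j))).
  by rewrite -(grid_col G) // (weq _ _ (LP _ nj)) (weq _ _ (LP _ (ltnW nj))) wE.
pose M : mgraph n r := [ffun p : 'I_n * 'I_n => inord (M0 p.1 p.2)].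
have entM i j : i < n -> j < n -> entry M i j = M0 i j.
  move=> ni nj; rewrite (entryE M (Ordinal ni) (Ordinal nj)) ffunE /= inordK //.
  by rewrite ltnS -(rM0 i ni) (bigD1 (Ordinal nj)) //= leq_addr.
have GM : grid d n (entry M) L.
  by case: G => G0 G1 GC; split=> // i j ni nj; rewrite entM //; apply: GC.
have regM : regular M.
  apply/regularP; split=> i ni; [apply: etrans (rM0 i ni)|apply: etrans (cM0 i ni)];
  by apply: eq_bigr => j _; rewrite entM.
have gM : good M by rewrite /good regM Lmax_chainlen (grid_chainlen GM).
exists M => //; have [P1 P2] := burge_part gM.
have dets := grid_det_fw (good_grid gM) GM (fun _ _ _ _ => erefl _).
have E1 : (burge M).1 = E.
  by apply: part_inj => j nj k; rewrite P1 // dets // LP.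
have E2 : (burge M).2 = E'.
  by apply: part_inj => j nj k; rewrite P2 // dets // LQ.
by rewrite -E1 -E2 -surjective_pairing.
Qed.

Lemma card_tableau_pairs : g r n d = #|tableau_pairs|.
Proof.
rewrite /g -(card_in_imset (f := burge)); last first.
  by move=> M M'; rewrite !inE; apply: burge_inj.
congr #|pred_of_set _|; apply/setP => T; apply/imsetP/idP.
  by case=> M; rewrite inE => gM ->; apply: burge_in.
by case/burge_onto => M gM <-; exists M; rewrite // inE.
Qed.

End Burge.

(** * The Jacobi-Trudi formula *)

Local Open Scope ring_scope.

Section Extension.
Variables r d : nat.
Local Notation comp := {ffun 'I_d -> 'I_r.+1}.
Local Notation filling n := {ffun 'I_n -> comp}.

(** Appends a last letter, with [e k] copies in row [k]; the counts below are computed by induction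
    on the number of letters. *)
Definition extend n (eE : comp * filling n) : filling n.+1 :=
  [ffun i : 'I_n.+1 => if unlift ord_max i is Some j then eE.2 j else eE.1].

Lemma extend_bij n : bijective (@extend n).
Proof.
exists (fun E : filling n.+1 => (E ord_max, [ffun j : 'I_n => E (lift ord_max j)])).
  move=> [e E]; congr pair; first by rewrite ffunE unlift_none.
  by apply/ffunP => j; rewrite !ffunE liftK.
by move=> E; apply/ffunP => i; rewrite ffunE; case: unliftP => [j|] -> //=; rewrite ffunE.
Qed.

Lemma extend_last n e (E : filling n) : extend (e, E) ord_max = e.
Proof. by rewrite ffunE unlift_none. Qed.

Lemma extend_lift n e (E : filling n) j : extend (e, E) (lift ord_max j) = E j.
Proof. by rewrite ffunE liftK. Qed.

Lemma part_extend n e (E : filling n) i : (i <= n)%N ->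
  part (extend (e, E)) i =1 part E i.
Proof.
move=> ni k; rewrite /part big_mkcond big_ord_recr /= ltnNge ni addn0 [RHS]big_mkcond.
apply: eq_bigr => j _ /=; rewrite -(extend_lift e E j).
by have -> : widen_ord (leqnSn n) j = lift ord_max j
  by apply: val_inj; rewrite /= /bump leqNgt ltn_ord.
Qed.

Lemma part_extendS n e (E : filling n) k :
  part (extend (e, E)) n.+1 k = (part E n k + height e k)%N.
Proof. by rewrite (partS _ ord_max) part_extend // extend_last. Qed.

Lemma forall_ordS n (P : pred 'I_n.+1) :
  [forall i, P i] = P ord_max && [forall j, P (lift ord_max j)].
Proof.
apply/forallP/andP => [h|[h /forallP h'] i]; first by split=> //; apply/forallP=> j.
by case: (unliftP ord_max i) => [j|] ->.
Qed.

Definition composition (e : comp) := (\sum_(k < d) e k == r)%N.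

Lemma row_sums_extend n e (E : filling n) :
  row_sums (extend (e, E)) = composition e && row_sums E.
Proof.
rewrite /row_sums forall_ordS extend_last; congr andb.
by apply: eq_forallb => j; rewrite extend_lift.
Qed.

Lemma tableau_extend n e (E : filling n) : tableau (extend (e, E)) =
  [&& composition e, tableau E
    & [forall k : 'I_d, part E n k.+1 + height e k.+1 <= part E n k]%N].
Proof.
rewrite /tableau row_sums_extend -!andbA; congr andb; congr andb.
rewrite forall_ordS andbC /=; congr andb.
  apply: eq_forallb => j; apply: eq_forallb => k.
  have -> : bump n j = j by rewrite /bump leqNgt ltn_ord.
  by rewrite !part_extend // ltnW.
by apply: eq_forallb => k; rewrite part_extendS part_extend.
Qed.

Lemma card_extend n (P : pred (filling n.+1)) :
  #|[set E | P E]| = (\sum_e #|[set E | P (extend (e, E))]|)%N.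
Proof.
rewrite -sum1dep_card (reindex _ (onW_bij _ (@extend_bij n))) /=.
under [RHS]eq_bigr => e _ do rewrite -sum1dep_card.
by rewrite pair_big_dep /=; apply: eq_bigl => -[e E].
Qed.

End Extension.

Section JacobiTrudi.
Variables r d : nat.
Local Notation comp := {ffun 'I_d -> 'I_r.+1}.
Local Notation filling n := {ffun 'I_n -> comp}.
Local Notation vec := {ffun 'I_d -> int}.
Implicit Types (x y : vec) (e : comp) (s p : 'S_d).

Definition staircase (k : 'I_d) : int := (d - k.+1)%N.

Definition permute x s : vec := [ffun k => x (s k)].

Definition minus x e : vec := [ffun k => x k - (e k : nat)%:Z].

(** The coefficient of the monomial of exponent [x] in the [n]-th power of the complete symmetric
    polynomial of degree [r] in [d] variables; it is zero if [x] has a negative coordinate. *)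
Definition words n x : int :=
  #|[set E : filling n | row_sums E && [forall k : 'I_d, (part E n k)%:Z == x k]]|%:Z.

(* The shape is shifted by the staircase, which makes it strictly decreasing. *)
Definition kostka n x : int :=
  #|[set E : filling n | tableau E &&
      [forall k : 'I_d, (part E n k)%:Z + staircase k == x k]]|%:Z.

(** The coefficient of exponent [x] after multiplication of that power by the Vandermonde
    determinant. *)
Definition altwords n x : int :=
  \sum_(p : 'S_d) (-1) ^+ odd_perm p * words n [ffun k => x k - staircase (p k)].

Lemma words0 x : words 0 x = [forall k, x k == 0].
Proof.
rewrite /words;
have h (E : filling 0) : row_sums E && [forall k : 'I_d, (part E 0 k)%:Z == x k] = [forall k, x k == 0].
  have -> : row_sums E by apply/forallP => i; have := ltn_ord i; rewrite ltn0.
  by rewrite /=; apply: eq_forallb => k; rewrite part0 eq_sym.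
case: (boolP [forall k, x k == 0]) => hx.
  rewrite (_ : [set E | _] = setT); last by apply/setP => E; rewrite !inE h.
  by rewrite cardsT card_ffun card_ord expn0.
by rewrite (_ : [set E | _] = set0) ?cards0 //; apply/setP => E; rewrite !inE h (negbTE hx).
Qed.

Lemma wordsS n x : words n.+1 x = \sum_(e | composition e) words n (minus x e).
Proof.
rewrite /words card_extend -natz natr_sum [RHS]big_mkcond; apply: eq_bigr => e _.
case: ifPn => [ce|/negbTE ce]; last first.
  rewrite (_ : [set E | _] = set0) ?cards0 //; apply/setP => E.
  by rewrite !inE row_sums_extend ce.
rewrite natz; congr (#|pred_of_set _|%:Z); apply/setP => E.
rewrite !inE row_sums_extend ce; congr andb.
apply: eq_forallb => k; rewrite part_extendS heightE ffunE PoszD.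
by rewrite [RHS]eq_sym subr_eq eq_sym.
Qed.

(* With [x] a shifted shape, this says that removing [e] leaves a shape and that
   the removed boxes form a horizontal strip. *)
Definition leaves x e := [forall k : 'I_d, forall k' : 'I_d,
  (k' == k.+1 :> nat) ==> (x k' < x k - (e k : nat)%:Z)].

Lemma kostkaS n x : kostka n.+1 x =
  \sum_(e | composition e && leaves x e) kostka n (minus x e).
Proof.
rewrite /kostka card_extend -natz natr_sum [RHS]big_mkcond; apply: eq_bigr => e _.
have eqE (E : filling n) : [forall k : 'I_d, (part (extend (e, E)) n.+1 k)%:Z + staircase k == x k]
   = [forall k : 'I_d, (part E n k)%:Z + staircase k == minus x e k].
  apply: eq_forallb => k; rewrite part_extendS heightE ffunE PoszD.
  by rewrite [RHS]eq_sym subr_eq eq_sym addrAC.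
(* Consecutive coordinates of the staircase differ by one, which turns the weak inequality between
   row lengths into the strict one of [leaves]. *)
have lv (E : filling n) : [forall k : 'I_d, (part E n k)%:Z + staircase k == minus x e k] ->
    [forall k : 'I_d, part E n k.+1 + height e k.+1 <= part E n k]%N = leaves x e.
  move=> /forallP hx; apply: eq_forallb => k.
  have [kd|dk] := ltnP k.+1 d; last first.
    rewrite vanish_part // height_ge //; apply/esym/forallP => k'.
    by apply/implyP => /eqP k'E; have := ltn_ord k'; rewrite k'E ltnNge dk.
  have step (k' : 'I_d) : k' = k.+1 :> nat ->
      (part E n k.+1 + height e k.+1 <= part E n k)%N = (x k' < x k - (e k : nat)%:Z).
    move=> k'E; have /eqP := hx k; have /eqP := hx k'; rewrite !ffunE /staircase -k'E heightE.
    move: (ltn_ord k') (part E n k') (part E n k) (x k) (x k') (e k : nat) (e k' : nat).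
    by clear; lia.
  apply/idP/forallP => [h k'|/(_ (Ordinal kd))/implyP/(_ (eqxx _))]; last by rewrite -step.
  by apply/implyP => /eqP k'E; rewrite -step.
case: ifPn => [/andP[ce xe]|nce]; last first.
  rewrite (_ : [set E | _] = set0) ?cards0 //; apply/setP => E; rewrite !inE.
  rewrite tableau_extend eqE; apply: contraNF nce => /andP[/and3P[-> _ h1] h2].
  by rewrite -(lv _ h2).
rewrite natz; congr (#|pred_of_set _|%:Z); apply/setP => E.
rewrite !inE tableau_extend eqE ce /=.
by rewrite -andbA; congr andb; apply: andb_idl => /lv ->.
Qed.

(** Permuting the coordinates of every letter preserves the compositions of [r]. *)
Lemma words_permute n x s : words n (permute x s) = words n x.
Proof.
elim: n x => [|n IH] x.
  rewrite !words0; congr (nat_of_bool _)%:Z; apply/forallP/forallP => h k.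
    by have := h (s^-1%g k); rewrite ffunE permKV.
  by rewrite ffunE.
rewrite !wordsS.
pose h (t : 'S_d) e : comp := [ffun k => e (t k)].
have hK t : cancel (h t) (h t^-1%g).
  by move=> e; apply/ffunP => k; rewrite !ffunE permKV.
rewrite (reindex_inj (can_inj (hK s))); apply: eq_big => [e|e _].
  rewrite /composition [in RHS](reindex_inj (@perm_inj _ s)); congr (_ == _).
  by apply: eq_bigr => k _; rewrite ffunE.
rewrite -(IH (minus x e)); congr (words n _); apply/ffunP => k.
by rewrite !ffunE.
Qed.

Lemma altwords_permute n x s :
  altwords n (permute x s) = (-1) ^+ odd_perm s * altwords n x.
Proof.
rewrite /altwords (reindex_inj (mulgI s)) mulr_sumr; apply: eq_bigr => p _.
rewrite odd_permM signr_addb -mulrA; congr (_ * (_ * _)).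
rewrite -[RHS](words_permute _ _ s); congr (words n _); apply/ffunP => k.
by rewrite !ffunE permM.
Qed.

Lemma altwordsS n x :
  altwords n.+1 x = \sum_(e | composition e) altwords n (minus x e).
Proof.
rewrite /altwords exchange_big; apply: eq_bigr => p _.
rewrite wordsS mulr_sumr; apply: eq_bigr => e _; congr (_ * words n _).
by apply/ffunP => k; rewrite !ffunE addrAC.
Qed.

Definition sdecr x := [forall i : 'I_d, forall j : 'I_d, (i < j)%N ==> (x j < x i)].

Lemma sdecrP x : reflect (forall i j : 'I_d, (i < j)%N -> x j < x i) (sdecr x).
Proof.
apply: (iffP forallP) => [h i j|h i]; first by move/forallP: (h i) => /(_ j)/implyP.
by apply/forallP => j; apply/implyP/h.
Qed.

Lemma sdecrE x i j : sdecr x -> (x j < x i) = (i < j)%N.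
Proof.
move/sdecrP => h; case: (ltngtP i j) => [/h //|/h|/val_inj ->]; last exact: ltxx.
by move=> /ltW; rewrite leNgt => /negbTE.
Qed.

Lemma sdecr_step x : (forall k k' : 'I_d, k' = k.+1 :> nat -> x k' < x k) -> sdecr x.
Proof.
move=> h; suff main m (i j : 'I_d) : j = (i + m.+1)%N :> nat -> x j < x i.
  by apply/sdecrP => i j ij; apply: (main (j - i.+1)%N); lia.
elim: m j => [|m IH] j jE; first by apply: h; rewrite jE addn1.
have jd : (i + m.+1 < d)%N by have := ltn_ord j; lia.
apply: lt_trans (h (Ordinal jd) j _) (IH _ _) => //=.
by rewrite jE addnS.
Qed.

(** An element of ['I_d] equals the number of elements below it, and a monotone permutation keeps
    this number. *)
Lemma perm_mono p : (forall i j, (p i < p j)%N = (i < j)%N) -> p = 1%g.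
Proof.
move=> mono; apply/permP => i; rewrite perm1; apply: val_inj => /=.
have card_lt (k : 'I_d) : #|[set j : 'I_d | (j < k)%N]| = k.
  rewrite -sum1dep_card -(big_ord_widen_cond d xpredT (fun=> 1%N)) ?(ltnW (ltn_ord k)) //.
  by rewrite sum1_card card_ord.
rewrite -[LHS]card_lt -[RHS]card_lt -(card_preimset _ (@perm_inj _ p)).
by apply: eq_card => j; rewrite !inE mono.
Qed.

(** Without letters, the term of [p] is nonzero only if [x] is the staircase permuted by [p]; as [x]
    decreases strictly, [p] is then the identity. *)
Lemma altwords0 x : sdecr x -> altwords 0 x = kostka 0 x.
Proof.
move=> dx; rewrite /altwords /kostka.
have kE : #|[set E : filling 0 | tableau E &&
      [forall k : 'I_d, (part E 0 k)%:Z + staircase k == x k]]|%:Z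
    = words 0 [ffun k => x k - staircase ((1%g : 'S_d) k)].
  rewrite /words; congr (#|pred_of_set _|%:Z); apply/setP => E; rewrite !inE.
  rewrite /tableau; have -> : row_sums E.
    by apply/forallP => i; have := ltn_ord i; rewrite ltn0.
  have -> : [forall i : 'I_0, forall k : 'I_d, (part E i.+1 k.+1 <= part E i k)%N].
    by apply/forallP => i; have := ltn_ord i; rewrite ltn0.
  apply: eq_forallb => k; rewrite ffunE perm1.
  by rewrite [RHS]eq_sym subr_eq eq_sym.
rewrite kE (bigD1 1%g) //= odd_perm1 expr0 mul1r big1 ?addr0 // => p p1.
rewrite words0; case: forallP => [h|_]; last by rewrite mulr0.
case/eqP: p1; apply: perm_mono => i j.
have xE k : x k = staircase (p k) by have := h k; rewrite ffunE subr_eq0 => /eqP.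
rewrite -(sdecrE i j dx) !xE /staircase.
by have := ltn_ord (p i); have := ltn_ord (p j); lia.
Qed.

(** Interpolates between no condition, at [m = 0], and [leaves x e], at [m = d]. *)
Definition leaves_below m x e := [forall k : 'I_d, forall k' : 'I_d,
  (k < m)%N && (k' == k.+1 :> nat) ==> (x k' < x k - (e k : nat)%:Z)].

Lemma leaves_belowP m x e :
  reflect (forall k k' : 'I_d, (k < m)%N -> k' = k.+1 :> nat -> x k' < x k - (e k : nat)%:Z)
          (leaves_below m x e).
Proof.
apply: (iffP forallP) => [h k k' km k'E|h k].
  by move/forallP: (h k) => /(_ k')/implyP; apply; rewrite km k'E /=.
by apply/forallP => k'; apply/implyP => /andP[km /eqP]; apply: h.
Qed.

(* The involution swaps coordinates [k] and [k'] of [x - e]. *)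
Section Exchange.
Variables (x : vec) (k k' : 'I_d).
Hypotheses (dx : sdecr x) (kk' : k' = k.+1 :> nat).

Definition exchange e : comp := [ffun j =>
  if j == k then inord `|x k - x k' + (e k' : nat)%:Z|
  else if j == k' then inord `|x k' - x k + (e k : nat)%:Z| else e j].

Definition first_bad e :=
  [&& composition e, leaves_below k x e & x k - (e k : nat)%:Z <= x k'].

(** Neither the absolute values nor [inord] alter the entries: the violation at [k] gives
    [x k - x k' <= e k], so both new entries lie between 0 and [e k + e k' <= r]. *)
Lemma exchangeE e : first_bad e ->
  [/\ (exchange e k : nat)%:Z = x k - x k' + (e k' : nat)%:Z,
      (exchange e k' : nat)%:Z = x k' - x k + (e k : nat)%:Z
    & forall j, j != k -> j != k' -> exchange e j = e j].
Proof.
case/and3P=> /eqP sumE _ bad.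
have nkk' : k' != k by rewrite -(inj_eq val_inj) /= kk' -[X in _ != X]addn0 -addn1 eqn_add2l.
have lt : x k' < x k by move/sdecrP: dx; apply; rewrite kk'.
have le : (e k + e k' <= r)%N.
  by rewrite -[X in (_ <= X)%N]sumE (bigD1 k) //= leq_add2l (bigD1 k') //= leq_addr.
split=> [||j jk jk']; rewrite ffunE ?eqxx ?(negbTE nkk') ?(negbTE jk) ?(negbTE jk') //.
  rewrite inordK; first by rewrite gez0_abs //; move: lt bad (e k : nat) (e k' : nat) le; lia.
  by move: lt bad le; move: (x k) (x k') (e k : nat) (e k' : nat); clear; lia.
rewrite inordK; first by move: lt bad le; move: (x k) (x k') (e k : nat) (e k' : nat); clear; lia.
by move: lt bad le; move: (x k) (x k') (e k : nat) (e k' : nat); clear; lia.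
Qed.

Lemma exchange_neq : k' != k.
Proof. by apply/eqP => E; move: kk'; rewrite E; apply/eqP; rewrite ltn_eqF. Qed.

(** After the exchange, coordinate [k] of [x - e] is [x k' - e k'], at most [x k'], so row [k] stays
    bad; the rows before [k] are untouched. *)
Lemma first_bad_exchange e : first_bad e -> first_bad (exchange e).
Proof.
move=> fe; have [Ek Ek' Ej] := exchangeE fe; have /and3P[sumE below bad] := fe.
have lt : x k' < x k by move/sdecrP: dx; apply; rewrite kk'.
apply/and3P; split; last by rewrite Ek opprD addrA subKr gerBl.
  apply/eqP; apply: etrans (eqP sumE).
  rewrite (bigD1 k) // (bigD1 k') ?exchange_neq //= [RHS](bigD1 k) //.
  rewrite [in RHS](bigD1 k') ?exchange_neq //= !addnA; congr addn.
    by move: Ek Ek'; move: (x k) (x k') (exchange e k : nat) (exchange e k' : nat);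
      move: (e k : nat) (e k' : nat); clear; lia.
  by apply: eq_bigr => j /andP[jk jk']; rewrite Ej.
apply/leaves_belowP => i i' ik ii'; rewrite Ej; last 2 first.
- by apply/eqP => E; rewrite E ltnn in ik.
- by apply/eqP => E; move: ik; rewrite E kk' ltnNge leqnSn.
by move/leaves_belowP: below; apply.
Qed.

Lemma exchangeK e : first_bad e -> exchange (exchange e) = e.
Proof.
move=> fe; have [Ek Ek' Ej] := exchangeE fe.
have [Fk Fk' Fj] := exchangeE (first_bad_exchange fe).
apply/ffunP => j; apply: val_inj => /=.
have [->|jk] := eqVneq j k.
  by apply/eqP; rewrite -eqz_nat Fk Ek' addrA subrKA subrr add0r.
have [->|jk'] := eqVneq j k'.
  by apply/eqP; rewrite -eqz_nat Fk' Ek addrA subrKA subrr add0r.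
by rewrite Fj // Ej.
Qed.

Lemma minus_exchange e : first_bad e ->
  minus x (exchange e) = permute (minus x e) (tperm k k').
Proof.
move=> fe; have [Ek Ek' Ej] := exchangeE fe.
apply/ffunP => j; rewrite [LHS]ffunE [RHS]ffunE [RHS]ffunE; case: tpermP => [->|->|/eqP jk /eqP jk'].
- by rewrite Ek opprD addrA subKr.
- by rewrite Ek' opprD addrA subKr.
by rewrite Ej.
Qed.

(** The exchange is an involution on these [e] and transposes two coordinates of [x - e], so
    antisymmetry makes the sum its own opposite. *)
Lemma sum_first_bad n : \sum_(e | first_bad e) altwords n (minus x e) = 0.
Proof.
set S := LHS; suff : S = - S by move: S; lia.
rewrite /S [LHS](reindex_onto exchange exchange) /=; last exact: exchangeK.
rewrite -sumrN; apply: eq_big => [e|e /andP[fe /eqP eK]].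
  apply/andP/idP => [[fe /eqP <-]|fe]; first exact: first_bad_exchange.
  by rewrite first_bad_exchange // exchangeK.
rewrite minus_exchange ?altwords_permute; last by rewrite -eK first_bad_exchange.
by rewrite odd_tperm eq_sym exchange_neq expr1 mulN1r.
Qed.

End Exchange.

(** Passing from [m] to [m.+1] discards exactly the [e] whose first bad row is [m], and these
    cancel. For the last row there is no next coordinate and nothing is discarded. *)
Lemma sum_leaves_below n m x : sdecr x ->
  \sum_(e | composition e) altwords n (minus x e) =
  \sum_(e | composition e && leaves_below m x e) altwords n (minus x e).
Proof.
move=> dx; elim: m => [|m IH].
  by apply: eq_bigl => e; rewrite (_ : leaves_below 0 x e) ?andbT //; apply/leaves_belowP.
rewrite IH (bigID (leaves_below m.+1 x)) /= [X in _ + X](_ : _ = 0) ?addr0.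
  apply: eq_bigl => e; rewrite -andbA; congr andb; apply: andb_idl.
  move/leaves_belowP => h; apply/leaves_belowP => k k' km; apply: h; exact: ltnW.
have [md|dm] := ltnP m.+1 d; last first.
  rewrite big1 // => e /andP[/andP[_ /leaves_belowP h]] /leaves_belowP[] k k' km kk'.
  by apply: h => //; have := ltn_ord k'; lia.
pose k : 'I_d := Ordinal (ltnW md); pose k' : 'I_d := Ordinal md.
rewrite -[RHS](@sum_first_bad x k k' dx erefl n); apply: eq_bigl => e.
rewrite /first_bad -andbA; congr andb; apply: andb_id2l => /leaves_belowP h.
rewrite leNgt; congr negb; apply/leaves_belowP/idP => [/(_ k k')|lt i i' im ii'].
  by apply; rewrite /= ?ltnSn.
have [im'|mi] := ltnP i m; first exact: h.
have -> : i = k by apply: val_inj; rewrite /=; lia.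
by have -> : i' = k' by apply: val_inj; rewrite /=; lia.
Qed.

(** Both sides satisfy a recursion over the last letter; the one for [altwords] runs over all
    compositions and is cut down to those in [leaves] by [sum_leaves_below]. For these [x - e] is
    again strictly decreasing. *)
Theorem kostka_altwords n x : sdecr x -> kostka n x = altwords n x.
Proof.
elim: n x => [|n IH] x dx; first by rewrite altwords0.
rewrite kostkaS altwordsS (sum_leaves_below n d dx); apply: eq_big => [e|e].
  congr andb; apply/forallP/leaves_belowP => h k.
    by move=> k' _ k'E; move/forallP: (h k) => /(_ k')/implyP; apply; apply/eqP.
  by apply/forallP => k'; apply/implyP => /eqP; apply: h.
case/andP=> _ /forallP lv; apply: IH; apply: sdecr_step => k k' k'E.
rewrite !ffunE; move/forallP: (lv k) => /(_ k')/implyP; rewrite k'E eqxx => /(_ isT).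
by apply: le_lt_trans; rewrite gerBl.
Qed.

End JacobiTrudi.

(** * Walks and words *)

Section Walks.
Variables n r d : nat.
Hypotheses (r_gt0 : (0 < r)%N) (d_gt0 : (0 < d)%N).
Local Notation word := {ffun 'I_(r * n) -> 'I_d}.
Local Notation filling := {ffun 'I_n -> {ffun 'I_d -> 'I_r.+1}}.
Implicit Types (a b : word) (E : filling).

Lemma index_subproof (i : 'I_n) (s : 'I_r) : (i * r + s < r * n)%N.
Proof.
rewrite [X in (_ < X)%N]mulnC; apply: (@leq_trans (i.+1 * r)%N); last by rewrite leq_mul2r ltn_ord orbT.
by rewrite mulSn addnC ltn_add2r.
Qed.

Definition index_of i s : 'I_(r * n) := Ordinal (index_subproof i s).

Lemma block_subproof (k : 'I_(r * n)) : (k %/ r < n)%N.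
Proof. by rewrite ltn_divLR // [X in (_ < X)%N]mulnC. Qed.

Definition block_of k : 'I_n := Ordinal (block_subproof k).
Definition offset_of (k : 'I_(r * n)) : 'I_r := Ordinal (ltn_pmod k r_gt0).

Lemma index_ofK k : index_of (block_of k) (offset_of k) = k.
Proof. by apply: val_inj; rewrite /= -divn_eq. Qed.

Lemma block_ofK i s : block_of (index_of i s) = i.
Proof. by apply: val_inj; rewrite /= divnMDl // divn_small ?addn0. Qed.

Lemma offset_ofK i s : offset_of (index_of i s) = s.
Proof. by apply: val_inj; rewrite /= modnMDl modn_small. Qed.

Lemma sum_blocks (f : 'I_(r * n) -> nat) :
  (\sum_k f k = \sum_i \sum_s f (index_of i s))%N.
Proof.
rewrite pair_big /= (reindex (fun p : 'I_n * 'I_r => index_of p.1 p.2)) //=.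
exists (fun k => (block_of k, offset_of k)) => [[i s] _|k _] /=.
  by rewrite block_ofK offset_ofK.
exact: index_ofK.
Qed.

Definition block a (i : 'I_n) : seq 'I_d := [seq a (index_of i s) | s <- enum 'I_r].

Lemma size_block a i : size (block a i) = r.
Proof. by rewrite size_map size_enum_ord. Qed.

Lemma nth_block x0 a i (s : 'I_r) : nth x0 (block a i) s = a (index_of i s).
Proof. by rewrite (nth_map s) ?size_enum_ord // nth_ord_enum. Qed.

Definition geq_ord : rel 'I_d := fun x y => (y <= x)%N.

(** The guard [(k %% r).+1 < r] in [block_decr] says that positions [k] and [k.+1] belong to the
    same block. *)
Lemma block_decrP a : reflect (forall i, sorted geq_ord (block a i)) (block_decr a).
Proof.
pose x0 : 'I_d := Ordinal d_gt0.
apply: (iffP forallP) => [h i|h k].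
  apply/(sortedP x0) => s; rewrite size_block => sr.
  rewrite (nth_block x0 a i (Ordinal (ltnW sr))) (nth_block x0 a i (Ordinal sr)).
  move/forallP: (h (index_of i (Ordinal (ltnW sr)))).
  move=> /(_ (index_of i (Ordinal sr)))/implyP; apply.
  by rewrite /= addnS eqxx /= modnMDl modn_small // ltnW.
apply/forallP => k'; apply/implyP => /andP[/eqP k'E kr].
have := h (block_of k) => /(sortedP x0) /(_ (k %% r)%N); rewrite size_block => /(_ kr).
rewrite (nth_block x0 a _ (offset_of k)) (nth_block x0 a _ (Ordinal kr)) index_ofK.
congr (is_true (_ <= _)%N); congr (nat_of_ord (a _)); apply: val_inj.
by rewrite /= addnS -divn_eq k'E.
Qed.

Definition block_counts a : filling :=
  [ffun i => [ffun j : 'I_d => inord (count_mem j (block a i))]].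

Lemma block_countsE a i j : block_counts a i j = count_mem j (block a i) :> nat.
Proof. by rewrite !ffunE inordK // ltnS -(size_block a i) count_size. Qed.

Lemma sum_count (s : seq 'I_d) : (\sum_j count_mem j s = size s)%N.
Proof.
elim: s => [|x s IH] /=; first by rewrite big1.
rewrite big_split /= IH (bigD1 x) //= eqxx big1 // => j /negbTE jx.
by rewrite eq_sym jx.
Qed.

Lemma row_sums_block_counts a : row_sums (block_counts a).
Proof.
apply/forallP => i; under eq_bigr do rewrite block_countsE.
by rewrite sum_count size_block.
Qed.

Lemma part_block_counts a (j : 'I_d) :
  part (block_counts a) n j = (\sum_k (a k == j))%N.
Proof.
rewrite /part sum_blocks; apply: eq_big => [i|i _]; first by rewrite ltn_ord.
rewrite heightE block_countsE /block count_map -sum1_count big_enum_cond /=.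
by rewrite [RHS]big_mkcond /= [LHS]big_mkcond; apply: eq_bigr => s _ /=; case: eqP.
Qed.

(** A sorted block is determined by the multiplicities of its letters. *)
Lemma block_counts_inj : {in [pred a | block_decr a] &, injective block_counts}.
Proof.
move=> a b /block_decrP da /block_decrP db eqab.
have eqB i : block a i = block b i.
  apply: (sorted_eq (leT := geq_ord)) => //.
  - by move=> y x z xy yz; apply: leq_trans yz xy.
  - by move=> x y yxy; apply/esym/val_inj/anti_leq.
  apply/allP => j _ /=; apply/eqP.
  by rewrite -!block_countsE eqab.
apply/ffunP => k; rewrite -(index_ofK k).
by rewrite -!(nth_block (Ordinal d_gt0)) eqB.
Qed.

Lemma block_counts_onto E : row_sums E ->
  exists2 a, block_decr a & block_counts a = E.
Proof.
move=> /forallP rE; pose x0 : 'I_d := Ordinal d_gt0.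
pose w i := sort geq_ord (flatten [seq nseq (E i j) j | j <- enum 'I_d]).
have cw i j : count_mem j (w i) = E i j.
  rewrite (seq.permP (permEl (perm_sort _ _))) count_flatten -map_comp sumnE big_map big_enum /=.
  rewrite (bigD1 j) //= count_nseq /= eqxx mul1n big1 ?addn0 // => l /negbTE lj.
  by rewrite count_nseq /= lj.
have sw i : size (w i) = r.
  by rewrite -sum_count -[RHS](eqP (rE i)); apply: eq_bigr => j _; rewrite cw.
pose a : word := [ffun k => nth x0 (w (block_of k)) (offset_of k)].
have bw i : block a i = w i.
  apply: (@eq_from_nth _ x0); first by rewrite size_block sw.
  move=> s; rewrite size_block => sr.
  rewrite (nth_block x0 a i (Ordinal sr)) ffunE block_ofK.
  by rewrite -[X in nth _ _ X]/(val _) offset_ofK.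
exists a.
  apply/block_decrP => i; rewrite bw; apply: sort_sorted => x y.
  by rewrite /geq_ord leq_total.
by apply/ffunP => i; apply/ffunP => j; apply: val_inj; rewrite /= block_countsE bw cw.
Qed.

(** Once the letter counts [E] of the positive steps are chosen, the endpoint prescribes the total
    content of the negative steps. *)
Lemma card_Wprime (pt : 'I_d -> int) : #|Wprime r n pt|%:Z =
  \sum_(E : filling | row_sums E) words r n [ffun j : 'I_d => (part E n j)%:Z - pt j].
Proof.
pose f (w : word * word) := (block_counts w.1, block_counts w.2).
pose S := [set EE : filling * filling | [&& row_sums EE.1, row_sums EE.2
   & [forall j : 'I_d, (part EE.1 n j)%:Z - (part EE.2 n j)%:Z == pt j]]].
have endE a b : [forall j, walk_end a b j == pt j] = [forall j : 'I_d,
   (part (block_counts a) n j)%:Z - (part (block_counts b) n j)%:Z == pt j].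
  apply: eq_forallb => j; rewrite /walk_end !part_block_counts -!natz !natr_sum.
  by congr (_ - _ == _); apply: eq_bigr => k _; rewrite natz.
have -> : #|Wprime r n pt| = #|S|.
  rewrite -(card_in_imset (f := f)); last first.
    move=> [a b] [a' b']; rewrite !inE /= => /andP[/andP[_ ha] hb] /andP[/andP[_ ha'] hb'].
    by case=> /block_counts_inj -> // /block_counts_inj -> .
  congr #|pred_of_set _|; apply/setP => -[E E']; apply/imsetP/idP.
    case=> -[a b]; rewrite inE /= => /andP[/andP[ab _] _] [-> ->].
    by rewrite inE /= !row_sums_block_counts -endE.
  rewrite inE /= => /and3P[/block_counts_onto[a da aE] /block_counts_onto[b db bE] ends].
  exists (a, b); last by rewrite /f /= aE bE.
  by rewrite inE /= da db endE aE bE ends.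
rewrite -sum1dep_card -(pair_big_dep _ (fun E E' => row_sums E' &&
   [forall j : 'I_d, (part E n j)%:Z - (part E' n j)%:Z == pt j]) (fun _ _ => 1%N)).
rewrite -natz natr_sum; apply: eq_bigr => E _; rewrite natz sum1dep_card.
rewrite /words; congr (#|pred_of_set _|%:Z); apply/setP => E'; rewrite !inE; congr andb.
apply: eq_forallb => j; rewrite ffunE [RHS]eq_sym !subr_eq.
by rewrite [pt j + _]addrC.
Qed.

End Walks.

(** * Symmetrization *)

Section Sorting.
Variables r d n : nat.
Implicit Types (x y : {ffun 'I_d -> int}) (s t : 'S_d).

(** The rank of an index is the number of larger values; the inverse of the rank permutation sorts
    [y]. *)
Lemma sorting_exists y : injective y -> exists s, sdecr (permute y s).
Proof.
move=> yI; pose rank (k : 'I_d) := #|[set j | y k < y j]|.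
have rank_lt k : (rank k < d)%N.
  rewrite -[X in (_ < X)%N]card_ord -cardsT; apply/proper_card/properP; split=> //.
  by exists k; rewrite ?inE ?ltxx.
have rank_mono k l : y k <= y l -> (rank l <= rank k)%N.
  move=> kl; apply/subset_leq_card/subsetP => j; rewrite !inE; exact: le_lt_trans.
have rank_ltE k l : y k < y l -> (rank l < rank k)%N.
  move=> kl; apply/proper_card/properP; split.
    by apply/subsetP => j; rewrite !inE; apply/lt_trans.
  by exists l; rewrite !inE ?ltxx.
have rankI : injective (fun k => Ordinal (rank_lt k)).
  move=> k l [] E; apply: yI.
  by case: (ltgtP (y k) (y l)) => // /rank_ltE; rewrite E ltnn.
exists ((perm rankI)^-1)%g; apply/sdecrP => i j ij; rewrite !ffunE ltNge.
apply/negP => /rank_mono.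
have rankV (l : 'I_d) : rank ((perm rankI)^-1%g l) = l.
  by rewrite -[RHS](congr1 val (permKV (perm rankI) l)) permE.
by rewrite !rankV leqNgt ij.
Qed.

Lemma sorting_unique y s t : sdecr (permute y s) -> sdecr (permute y t) -> s = t.
Proof.
move=> ds dt; suff E : (t * s^-1)%g = 1%g by apply/esym/eqP; rewrite eq_mulgV1 E.
apply: perm_mono => i j; rewrite -(sdecrE i j dt) -(sdecrE _ _ ds).
by rewrite !ffunE !permM !permKV.
Qed.

(** Each summand equals [altwords r n y], since the sign occurs twice. If [y] is injective, exactly
    one [s] sorts it; otherwise a transposition fixes [y] and antisymmetry gives zero. *)
Lemma altwords_sorting y : altwords r n y =
  \sum_(s | sdecr (permute y s)) (-1) ^+ odd_perm s * altwords r n (permute y s).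
Proof.
under eq_bigr do rewrite altwords_permute mulrA -signr_addb addbb mul1r.
have [/injectiveP/sorting_exists[s ds]|/injectivePn[i [j ij yij]]] := boolP (injectiveb y).
  rewrite (big_pred1 s) // => t; apply/idP/eqP => [dt|->//].
  exact: sorting_unique dt ds.
have y0 : altwords r n y = 0.
  have : permute y (tperm i j) = y.
    by apply/ffunP => k; rewrite ffunE; case: tpermP => [->|->|].
  move/(congr1 (altwords r n)); rewrite altwords_permute odd_tperm ij expr1 mulN1r.
  by move: (altwords r n y); lia.
by rewrite y0 big1.
Qed.

End Sorting.

(** * Both sides as a sum of squares over strictly decreasing vectors *)

Section Main.
Variables n r d : nat.
Hypotheses (r_gt0 : (0 < r)%N) (d_gt0 : (0 < d)%N).
Local Notation filling := {ffun 'I_n -> {ffun 'I_d -> 'I_r.+1}}.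
Local Notation vec := {ffun 'I_d -> int}.
Local Notation box := {ffun 'I_d -> 'I_(n * r + d).+1}.
Implicit Types (E : filling) (u : box).

Definition content E : vec := [ffun k : 'I_d => (part E n k)%:Z + staircase k].

(** The type [box] is a finite range of vectors containing every permuted content, so that sums over
    vectors become finite sums. *)
Definition box_vec u : vec := [ffun k => (u k : nat)%:Z].

Lemma part_le E i k : (part E i k <= n * r)%N.
Proof.
rewrite -[X in (_ <= X * _)%N]card_ord -sum_nat_const /part big_mkcond leq_sum // => j _.
case: ifP => // _; have [kd|dk] := ltnP k d; last by rewrite height_ge.
by rewrite (heightE _ (Ordinal kd)) -ltnS.
Qed.

Lemma sum_by_value (P : pred filling) s (phi : vec -> int) :
  \sum_(E | P E) phi (permute (content E) s) =
  \sum_u #|[set E | P E && (permute (content E) s == box_vec u)]|%:Z * phi (box_vec u).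
Proof.
pose f E : box := [ffun k => inord (part E n (s k) + (d - (s k).+1))].
have fE E : box_vec (f E) = permute (content E) s.
  apply/ffunP => k; rewrite !ffunE inordK ?PoszD //.
  by rewrite ltnS leq_add ?part_le ?leq_subr.
have box_inj : injective box_vec.
  by move=> u v /ffunP E; apply/ffunP => k; apply: val_inj; have := E k; rewrite !ffunE => -[].
rewrite (partition_big f predT) //=; apply: eq_bigr => u _.
rewrite (eq_bigr (fun=> phi (box_vec u))); last by move=> E /andP[_ /eqP <-]; rewrite fE.
rewrite sumr_const -mulr_natl natz; congr (_%:Z * _).
by apply: eq_card => E; rewrite !inE -fE (inj_eq box_inj).
Qed.

Let masked (phi : vec -> int) x := if sdecr x then phi x else 0.

Lemma content_tableau E : tableau E -> sdecr (content E).
Proof.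
move=> tE; apply: sdecr_step => k k' k'E; rewrite !ffunE /staircase k'E.
have {tE} : (part E n k.+1 <= part E n k)%N.
  rewrite /part; case: (n) E tE => [|m] E tE; first by rewrite !big_ord0.
  have [le1 _] := tableau_strip tE (ltnSn m) k.+1; have [_ le2] := tableau_strip tE (ltnSn m) k.
  by have [le3 _] := tableau_strip tE (ltnSn m) k; apply: leq_trans le2 le3.
have := ltn_ord k'; rewrite k'E.
by move: (part E n k.+1) (part E n k) (k : nat); clear; lia.
Qed.

(** For a fixed first tableau, the second ones of the same shape are counted by [kostka]. Grouping
    the first ones by shape squares this number. *)
Lemma g_altwords : (g r n d)%:Z =
  \sum_u masked (fun x => altwords r n x * altwords r n x) (box_vec u).
Proof.
have -> : (g r n d)%:Z = \sum_(E | tableau E) kostka r n (content E).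
  rewrite card_tableau_pairs // /tableau_pairs.
  rewrite -sum1dep_card -(pair_big_dep _ (fun E E' : filling => tableau E' &&
    [forall k : 'I_d, part E n k == part E' n k]) (fun _ _ => 1%N)).
  rewrite -natz natr_sum; apply: eq_bigr => E _; rewrite natz sum1dep_card.
  congr (#|pred_of_set _|%:Z); apply/setP => E'; rewrite !inE; congr andb.
  by apply: eq_forallb => k; rewrite ffunE (inj_eq (addIr _)) eqz_nat eq_sym.
have content1 E : permute (content E) 1%g = content E.
  by apply/ffunP => k; rewrite ffunE perm1.
rewrite (eq_bigr (fun E => masked (kostka r n) (permute (content E) 1%g))); last first.
  by move=> E /content_tableau tE; rewrite /masked content1 tE.
rewrite sum_by_value; apply: eq_bigr => u _; rewrite /masked.
case: ifP => [du|_]; last by rewrite mulr0.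
rewrite -kostka_altwords // /kostka; congr (_%:Z * _).
apply: eq_card => E; rewrite !inE content1; congr andb.
by apply/eqP/forallP => [/ffunP E1 k|E1]; [have := E1 k; rewrite ffunE => -> | apply/ffunP => k; rewrite ffunE; apply/eqP/E1].
Qed.

Lemma walks_altwords :
  \sum_(p : 'S_d) (-1) ^+ odd_perm p * #|Wprime r n (toeplitz p)|%:Z =
  \sum_u masked (fun x => altwords r n x * altwords r n x) (box_vec u).
Proof.
under eq_bigr do rewrite card_Wprime // mulr_sumr.
rewrite exchange_big /=.
(* The Toeplitz point is a difference of staircases: [toeplitz p k] is
   [staircase (p k) - staircase k]. *)
rewrite (eq_bigr (fun E => altwords r n (content E))); last first.
  move=> E _; apply: eq_bigr => p _; congr (_ * words r n _).
  apply/ffunP => k; rewrite !ffunE /toeplitz /staircase.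
  have := ltn_ord k; have := ltn_ord (p k).
  by move: (part E n k) (k : nat) (p k : nat); clear; lia.
(* Each content is sorted, and the fillings are grouped by the sorted vector [u]. One factor
   [altwords] comes from the summand; the other is assembled from the signed counts over the sorting
   permutations [s]. *)
under eq_bigr do rewrite altwords_sorting big_mkcond.
rewrite exchange_big /=.
under eq_bigr => s _.
  rewrite (eq_bigr (fun E => masked (fun x => (-1) ^+ odd_perm s * altwords r n x)
    (permute (content E) s))) //.
  rewrite sum_by_value.
  over.
rewrite exchange_big; apply: eq_bigr => u _; rewrite /masked /=.
case: ifP => _; last by rewrite big1 // => s _; rewrite mulr0.
rewrite -[RHS]/(_ * \sum_(p : 'S_d) (-1) ^+ odd_perm p *
  words r n [ffun k => box_vec u k - staircase (p k)]).
rewrite mulr_sumr; apply: eq_bigr => s _.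
rewrite [LHS]mulrC -[LHS]mulrA [LHS]mulrCA; congr (_ * (_ * _)).
(* Fillings whose content permuted by [s] is [u] have the row totals [u (s^-1 k) - staircase k],
   that is, the argument in the term of [s] permuted by [s^-1]. *)
rewrite -[RHS](words_permute _ _ _ s^-1%g) /words; congr (_%:Z); apply: eq_card => E.
rewrite !inE; congr andb; apply/eqP/forallP => [/ffunP E1 k|E1].
  have := E1 (s^-1%g k); rewrite !ffunE permKV => <-.
  by rewrite addrK.
apply/ffunP => k; have /eqP := E1 (s k).
by rewrite !ffunE permK => ->; rewrite subrK.
Qed.

End Main.

Theorem theorem1 (n r d : nat) :
  (1 <= n)%N -> (1 <= r)%N -> (1 <= d)%N ->
  (g r n d)%:Z =
  \sum_(p : 'S_d) (-1) ^+ (odd_perm p) * (#|@Wprime r n d (toeplitz p)|)%:Z.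
Proof. by move=> _ r1 d1; rewrite g_altwords // walks_altwords. Qed.
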